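(* Let $A:(\mathbb{R}^d)^n\to\Pi_n$ be a clustering rule, let $X(0),X(1),X(2),\dots$ be a sequence of configurations in $(\mathbb{R}^d)^n$, and set $P^{(t)}=A(X(t))$ and $\delta_t=\|X(t+1)-X(t)\|$ for integers $t\ge0$. Let $t\ge 0$ be an integer. If $$\sum_{s=0}^{t-1}\delta_s<r(X(0),A),$$ where $r(X(0),A)$ is the stability radius of the initial configuration, then $P^{(t)}=P^{(0)}$.
   Context: Here $n\ge 2$ and $\Pi_n$ is the set of all partitions of $[n]=\{1,\dots,n\}$ into nonempty blocks. A clustering rule is any map $A:(\mathbb{R}^d)^n\to\Pi_n$. For $X=(x_1,\dots,x_n)$ and $X'=(x_1',\dots,x_n')$ in $(\mathbb{R}^d)^n$, $\|X-X'\|=\max_{1\le i\le n}\|x_i-x_i'\|$ with $\|\cdot\|$ the Euclidean norm on $\mathbb{R}^d$. The stability radius is $r(X,A)=\sup\{\varepsilon\ge0: A(X')=A(X)\text{ for all }X'\text{ with }\|X-X'\|\le\varepsilon\}$, the supremum being taken in $[0,\infty]$. *)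

(* Defs.v *)
From mathcomp Require Import all_boot all_order all_algebra.
From mathcomp Require Import classical_sets reals ereal constructive_ereal.

Set Implicit Arguments.
Unset Strict Implicit.
Unset Printing Implicit Defensive.

Import Order.TTheory GRing.Theory Num.Theory.
Local Open Scope ring_scope.
Local Open Scope classical_set_scope.

Definition config (R : realType) (n d : nat) : Type := {ffun 'I_n -> 'rV[R]_d}.

(* Blocks of a MathComp partition are nonempty by definition. *)
Definition clustering (n : nat) : Type :=
  {P : {set {set 'I_n}} | finset.partition P [set: 'I_n]%SET}.

Definition clustering_rule (R : realType) (n d : nat) : Type :=
  config R n d -> clustering n.

(* The library's norm on row vectors is the sup norm, not the Euclidean one. *)
Definition euclidean_norm (R : realType) (d : nat) (v : 'rV[R]_d) : R :=
  Num.sqrt (\sum_(j < d) v ord0 j ^+ 2).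

(* The base value 0 does not affect the maximum: the terms are nonnegative. *)
Definition config_dist (R : realType) (n d : nat) (X X' : config R n d) : R :=
  \big[Num.max/0]_(i < n) euclidean_norm (X i - X' i).

Definition stability_radius (R : realType) (n d : nat) (X : config R n d)
    (A : clustering_rule R n d) : \bar R :=
  ereal_sup [set e%:E | e in
    [set e : R | 0 <= e /\
      forall X' : config R n d, config_dist X X' <= e -> A X' = A X]].

(* Main.v *)
Require Import Defs.
From mathcomp Require Import all_boot all_order all_algebra.
From mathcomp Require Import classical_sets reals ereal constructive_ereal.
From mathcomp Require Import ring lra.

Set Implicit Arguments.
Unset Strict Implicit.
Unset Printing Implicit Defensive.

Import Order.TTheory GRing.Theory Num.Theory.
Local Open Scope ring_scope.

(** The stability radius is a supremum of radii of closed balls around the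
    initial configuration on which the rule is constant.  A number strictly
    below that supremum is below one such radius, so every configuration within
    that distance of the initial one is clustered alike.  It remains to see
    that the total displacement of the trajectory bounds the distance from its
    start to its current point: this is the triangle inequality for
    [config_dist] ([config_distD]), iterated along the trajectory
    ([config_dist_path]).  The inequality for the maximum over the points
    follows from the one for the Euclidean norm ([euclidean_normD]), which
    rests on Cauchy-Schwarz ([sum_CauchySchwarz]).  The supremum is treated in
    [eq_cluster_lt_stability_radius]. *)

(** Lagrange's identity: the difference of the two sides is half of the sum of
    the squares [(u i * v j - u j * v i) ^+ 2] over all pairs of indices. *)
Lemma sum_CauchySchwarz (R : realDomainType) (I : finType) (u v : I -> R) :
  (\sum_i u i * v i) ^+ 2 <= (\sum_i u i ^+ 2) * (\sum_i v i ^+ 2).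
Proof.
have prodE (f g : I -> R) :
    (\sum_i f i) * (\sum_i g i) = \sum_i \sum_j f i * g j.
  by rewrite mulr_suml; apply: eq_bigr => i _; rewrite mulr_sumr.
have : 0 <= \sum_i \sum_j (u i * v j - u j * v i) ^+ 2.
  by do 2![apply: sumr_ge0 => ? _]; exact: sqr_ge0.
have -> : \sum_i \sum_j (u i * v j - u j * v i) ^+ 2 =
    (\sum_i u i ^+ 2) * (\sum_i v i ^+ 2) +
    (\sum_i v i ^+ 2) * (\sum_i u i ^+ 2) -
    2 * ((\sum_i u i * v i) * (\sum_i u i * v i)).
  rewrite !prodE mulr_sumr -big_split -sumrB; apply: eq_bigr => i _.
  rewrite mulr_sumr -big_split -sumrB; apply: eq_bigr => j _ /=.
  by ring.
by move=> ?; lra.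
Qed.

Lemma euclidean_norm_ge0 (R : realType) (d : nat) (v : 'rV[R]_d) :
  0 <= euclidean_norm v.
Proof. exact: sqrtr_ge0. Qed.

Lemma sqr_euclidean_norm (R : realType) (d : nat) (v : 'rV[R]_d) :
  euclidean_norm v ^+ 2 = \sum_(j < d) v ord0 j ^+ 2.
Proof. by rewrite sqr_sqrtr // sumr_ge0 // => j _; exact: sqr_ge0. Qed.

Lemma euclidean_normN (R : realType) (d : nat) (v : 'rV[R]_d) :
  euclidean_norm (- v) = euclidean_norm v.
Proof.
by congr Num.sqrt; apply: eq_bigr => j _; rewrite mxE sqrrN.
Qed.

Lemma euclidean_normD (R : realType) (d : nat) (u v : 'rV[R]_d) :
  euclidean_norm (u + v) <= euclidean_norm u + euclidean_norm v.
Proof.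
have uv_le : \sum_(j < d) u ord0 j * v ord0 j <=
    euclidean_norm u * euclidean_norm v.
  apply: le_trans (ler_norm _) _.
  rewrite -ler_sqr ?nnegrE ?mulr_ge0 ?euclidean_norm_ge0 ?normr_ge0 //.
  rewrite real_normK ?num_real // exprMn !sqr_euclidean_norm.
  exact: sum_CauchySchwarz.
rewrite -ler_sqr ?nnegrE ?addr_ge0 ?euclidean_norm_ge0 //.
have -> : euclidean_norm (u + v) ^+ 2 =
    euclidean_norm u ^+ 2 + 2 * (\sum_(j < d) u ord0 j * v ord0 j) +
    euclidean_norm v ^+ 2.
  rewrite !sqr_euclidean_norm mulr_sumr -!big_split.
  by apply: eq_bigr => j _ /=; rewrite mxE; ring.
by rewrite sqrrD; lra.
Qed.

Lemma config_dist_ge0 (R : realType) (n d : nat) (X Y : config R n d) :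
  0 <= config_dist X Y.
Proof. exact: bigmax_ge_id. Qed.

Lemma config_dist_self (R : realType) (n d : nat) (X : config R n d) :
  config_dist X X = 0.
Proof.
apply/le_anti; rewrite config_dist_ge0 andbT.
apply: bigmax_le => // i _; rewrite subrr /euclidean_norm big1 ?sqrtr0 //.
by move=> j _; rewrite mxE expr0n.
Qed.

Lemma config_distC (R : realType) (n d : nat) (X Y : config R n d) :
  config_dist X Y = config_dist Y X.
Proof. by apply: eq_bigr => i _; rewrite -euclidean_normN opprB. Qed.

Lemma config_distD (R : realType) (n d : nat) (Y X Z : config R n d) :
  config_dist X Z <= config_dist X Y + config_dist Y Z.
Proof.
apply: bigmax_le => [|i _]; first by rewrite addr_ge0 ?config_dist_ge0.
rewrite -(subrKA (Y i)); apply: le_trans (euclidean_normD _ _) _.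
by apply: lerD;
  exact: (le_bigmax _ (fun k => euclidean_norm (_ k - _ k)) i).
Qed.

Lemma config_dist_path (R : realType) (n d : nat) (X : nat -> config R n d)
    (t : nat) :
  config_dist (X 0%N) (X t) <= \sum_(0 <= s < t) config_dist (X s.+1) (X s).
Proof.
elim: t => [|t IHt]; first by rewrite config_dist_self big_geq.
rewrite big_nat_recr //= (config_distC (X t.+1)).
by apply: le_trans (config_distD (X t) _ _) _; rewrite lerD2r.
Qed.

(** The inequality has to be strict: the supremum itself need not be an
    admissible radius, but any number strictly below it is exceeded by one. *)
Lemma eq_cluster_lt_stability_radius (R : realType) (n d : nat)
    (A : clustering_rule R n d) (X Y : config R n d) :
  ((config_dist X Y)%:E < stability_radius X A)%E -> A Y = A X.
Proof.
case/ereal_sup_gt => _ [e [_ stable_e] <-]; rewrite lte_fin => /ltW.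
exact: stable_e.
Qed.

Theorem proposition7p4 (R : realType) (n d : nat) (hn : (2 <= n)%N)
    (A : clustering_rule R n d) (X : nat -> config R n d)
    (P : nat -> clustering n) (hP : forall s : nat, P s = A (X s))
    (delta : nat -> R)
    (hdelta : forall s : nat, delta s = config_dist (X s.+1) (X s))
    (t : nat)
    (ht : ((\sum_(0 <= s < t) delta s)%:E < stability_radius (X 0%N) A)%E) :
  P t = P 0%N.
Proof.
rewrite !hP; apply: eq_cluster_lt_stability_radius; apply: le_lt_trans ht.
rewrite lee_fin (eq_bigr _ (fun s _ => hdelta s)).
exact: config_dist_path.
Qed.
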